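(* Let $X$ be a Euclidean space. For same grade blades $A,B\in\bigwedge^pX$ ($p\ge1$), $$\tilde A B=\|A\|\,\|B\|\,e^{\Phi_{A,B}},$$ where $\Phi_{A,B}$ is the oriented angle bivector from $[A]$ to $[B]$ (formed with given associated principal bases).
   Context: $X$ is an $n$-dimensional Euclidean space. $\bigwedge X$ is its exterior algebra, equipped with the Clifford geometric product (written by juxtaposition), for which $vw=v\cdot w+v\wedge w$ for $v,w\in X$. $\bigwedge X$ carries the usual inner product and norm $\|\cdot\|$. For $M\in\bigwedge X$, $e^M=\sum_{k\ge0}M^k/k!$. A $p$-blade ($p\ge1$) is $A=v_1\wedge\cdots\wedge v_p$ with $v_i\in X$ (possibly $0$); its reversion is $\tilde A=v_p\wedge\cdots\wedge v_1=(-1)^{p(p-1)/2}A$; if $A\ne0$, $[A]=\mathrm{span}(v_1,\ldots,v_p)$. For $A,B\neq0$ let $V=[A]$, $W=[B]$. Their principal angles $0\le\theta_1\le\cdots\le\theta_p\le\frac\pi2$ and associated principal bases (orthonormal bases) $(e_1,\ldots,e_p)$ of $V$ and $(f_1,\ldots,f_p)$ of $W$ are characterized by $e_i\cdot f_j=\delta_{ij}\cos\theta_i$ for all $i,j$. Let $d=\dim(V\cap W)$. The principal bivectors are $I_i=0$ for $i\le d$ and $I_i=\frac{e_i\wedge f_i}{\|e_i\wedge f_i\|}$ for $i>d$. The angle bivector is $\Phi_{V,W}=\sum_{i=1}^p\theta_iI_i$. Write $A=\epsilon_A\|A\|e_1\cdots e_p$ and $B=\epsilon_B\|B\|f_1\cdots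 f_p$ with $\epsilon_A,\epsilon_B\in\{1,-1\}$, and $\epsilon_{A,B}=\epsilon_A\epsilon_B$. The oriented angle bivector is $\Phi_{A,B}=\Phi_{V,W}$ if $\epsilon_{A,B}=1$, and $\Phi_{A,B}=\Phi_{V,W}-\pi I_p$ if $\epsilon_{A,B}=-1$. If $A=0$ or $B=0$, $\Phi_{A,B}=0$.
   Formalization: The case of nonzero A, B with [A]=[B] and opposite orientations (B a negative multiple of A) is excluded: there I_p=0 and all angles vanish, so Φ_{A,B}=0 and the right side is ‖A‖‖B‖, whereas ÃB=−‖A‖‖B‖. *)

(* Defs.v *)
From HB Require Import structures.
From mathcomp Require Import all_boot all_order all_algebra.
From mathcomp Require Import reals topology normedtype sequences trigo.

Set Implicit Arguments.
Unset Strict Implicit.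
Unset Printing Implicit Defensive.

Import Order.TTheory GRing.Theory Num.Theory.
Import numFieldNormedType.Exports.

Local Open Scope ring_scope.

(** The Euclidean space is 'rV[R]_n with its standard dot product. With
    (g_i)_(i < n) its standard basis, a multivector is given by its coordinates
    on the basis g_S = g_s1 /\ ... /\ g_sk (s1 < ... < sk) of the exterior
    algebra, indexed by the subsets S = {s1, ..., sk} of 'I_n. *)
Definition multivector (R : realType) (n : nat) := {ffun {set 'I_n} -> R}.

HB.instance Definition _ (R : realType) (n : nat) :=
  Choice.on (multivector R n).
HB.instance Definition _ (R : realType) (n : nat) :=
  GRing.Zmodule.on (multivector R n).

Section Scaling.
Variables (R : realType) (n : nat).
Implicit Types (a b : R) (M N : multivector R n).

Definition mvscale a M : multivector R n := [ffun S => a * M S].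

Fact mvscaleA a b M : mvscale a (mvscale b M) = mvscale (a * b) M.
Proof. by apply/ffunP=> S; rewrite !ffunE mulrA. Qed.

Fact mvscale1 : left_id 1 mvscale.
Proof. by move=> M; apply/ffunP=> S; rewrite !ffunE mul1r. Qed.

Fact mvscaleDr : right_distributive mvscale +%R.
Proof. by move=> a M N; apply/ffunP=> S; rewrite !ffunE mulrDr. Qed.

Fact mvscaleDl M : {morph mvscale^~ M : a b / a + b}.
Proof. by move=> a b; apply/ffunP=> S; rewrite !ffunE mulrDl. Qed.

HB.instance Definition _ := GRing.Zmodule_isLmodule.Build R (multivector R n)
  mvscaleA mvscale1 mvscaleDr mvscaleDl.

End Scaling.

Section SetSigns.
Variable n : nat.
Implicit Types S T U : {set 'I_n}.

Definition symdiff S T := (S :\: T) :|: (T :\: S).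

Definition inversions S T : nat := \sum_(i in S) \sum_(j in T) (j < i)%N.

Lemma in_symdiff S T i : (i \in symdiff S T) = (i \in S) (+) (i \in T).
Proof. by rewrite !inE; do 2!case: (_ \in _). Qed.

Lemma symdiffC : commutative symdiff.
Proof. by move=> S T; apply/setP=> i; rewrite !in_symdiff addbC. Qed.

Lemma symdiffA : associative symdiff.
Proof. by move=> S T U; apply/setP=> i; rewrite !in_symdiff addbA. Qed.

Lemma symdiff0 S : symdiff S set0 = S.
Proof. by apply/setP=> i; rewrite in_symdiff inE addbF. Qed.

Lemma symdiffv S : symdiff S S = set0.
Proof. by apply/setP=> i; rewrite in_symdiff inE addbb. Qed.

Lemma symdiffK S : involutive (symdiff S).
Proof. by move=> T; rewrite symdiffA symdiffv symdiffC symdiff0. Qed.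

Lemma eq_symdiff S T U : (symdiff S T == U) = (T == symdiff S U).
Proof. exact: (can2_eq (symdiffK S) (symdiffK S)). Qed.

Lemma symdiff_disjoint S T : [disjoint S & T] -> symdiff S T = S :|: T.
Proof.
move=> dST; apply/setP=> i; rewrite in_symdiff inE.
by case: (boolP (i \in S)) => //= iS; rewrite (disjointFr dST iS).
Qed.

Lemma inversionsE S T :
  inversions S T = \sum_i \sum_j ((i \in S) * (j \in T) * (j < i))%N.
Proof.
rewrite /inversions big_mkcond; apply: eq_bigr => i _.
case: (i \in S); last by rewrite big1.
rewrite big_mkcond; apply: eq_bigr => j _.
by case: (j \in T); rewrite // mul1n.
Qed.

Lemma odd_inversionsDl S T U :
  odd (inversions (symdiff S T) U)
  = odd (inversions S U) (+) odd (inversions T U).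
Proof.
rewrite -oddD.
have -> : (inversions S U + inversions T U
  = inversions (symdiff S T) U + (inversions (S :&: T) U).*2)%N.
  rewrite -addnn !inversionsE -!big_split; apply: eq_bigr => i _ /=.
  rewrite -!big_split; apply: eq_bigr => j _ /=; rewrite in_symdiff in_setI.
  by do 3!case: (_ \in _); case: (j < i)%N.
by rewrite oddD odd_double addbF.
Qed.

Lemma odd_inversionsDr S T U :
  odd (inversions S (symdiff T U))
  = odd (inversions S T) (+) odd (inversions S U).
Proof.
rewrite -oddD.
have -> : (inversions S T + inversions S U
  = inversions S (symdiff T U) + (inversions S (T :&: U)).*2)%N.
  rewrite -addnn !inversionsE -!big_split; apply: eq_bigr => i _ /=.
  rewrite -!big_split; apply: eq_bigr => j _ /=; rewrite in_symdiff in_setI.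
  by do 3!case: (_ \in _); case: (j < i)%N.
by rewrite oddD odd_double addbF.
Qed.

Lemma inversions0l T : inversions set0 T = 0%N.
Proof. by rewrite /inversions big_set0. Qed.

Lemma inversions0r S : inversions S set0 = 0%N.
Proof. by rewrite /inversions big1 // => i _; rewrite big_set0. Qed.

Lemma inversions1 i j : inversions [set i] [set j] = (j < i)%N.
Proof. by rewrite /inversions !big_set1. Qed.

End SetSigns.

Section Products.
Variables (R : realType) (n : nat).
Implicit Types (S T U : {set 'I_n}) (M N P : multivector R n).

Definition basis_blade S : multivector R n := [ffun T : {set 'I_n} => (T == S)%:R].

(** [inversions S T] transpositions sort the juxtaposition g_S g_T, and each
    g_i with i in S and T is then squared to 1: so
    g_S g_T = (-1)^(inversions S T) g_(symdiff S T). *)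
Definition geom_prod M N : multivector R n :=
  [ffun U : {set 'I_n} =>
     \sum_(S : {set 'I_n}) \sum_(T : {set 'I_n} | symdiff S T == U)
        (-1) ^+ inversions S T * (M S * N T)].

Definition wedge M N : multivector R n :=
  [ffun U : {set 'I_n} =>
     \sum_(S : {set 'I_n}) \sum_(T : {set 'I_n} | [disjoint S & T] && (S :|: T == U))
        (-1) ^+ inversions S T * (M S * N T)].

Lemma geom_prodE M N U :
  geom_prod M N U
  = \sum_S (-1) ^+ inversions S (symdiff S U) * (M S * N (symdiff S U)).
Proof.
rewrite ffunE; apply: eq_bigr => S _.
by under eq_bigl do rewrite eq_symdiff; rewrite big_pred1_eq.
Qed.

Lemma geom_prodA : associative geom_prod.
Proof.
move=> M N P; apply/ffunP=> U; rewrite !geom_prodE.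
under eq_bigr do rewrite geom_prodE !mulr_sumr.
under [RHS]eq_bigr do rewrite geom_prodE mulr_suml mulr_sumr.
rewrite [RHS]exchange_big /=; apply: eq_bigr => S _.
rewrite [RHS](reindex_inj (inv_inj (symdiffK S))) /=.
apply: eq_bigr => T _; rewrite symdiffK.
have -> : symdiff T (symdiff S U) = symdiff (symdiff S T) U.
  by rewrite symdiffA (symdiffC T).
set V := symdiff (symdiff S T) U; rewrite !mulrA.
have -> : symdiff S U = symdiff T V.
  by rewrite /V (symdiffC S T) -symdiffA symdiffK.
do 2!congr (_ * _); rewrite mulrAC; congr (_ * _); rewrite -!exprD.
rewrite -[LHS]signr_odd -[RHS]signr_odd !oddD.
rewrite (odd_inversionsDl S T V) (odd_inversionsDr S T V).
by do 3!case: (odd _).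
Qed.

Lemma geom_prod1l : left_id (basis_blade set0) geom_prod.
Proof.
move=> M; apply/ffunP=> U; rewrite geom_prodE (bigD1 set0) //= big1 ?addr0.
  by rewrite ffunE eqxx symdiffC symdiff0 inversions0l expr0 !mul1r.
by move=> S /negPf nS; rewrite ffunE nS mul0r mulr0.
Qed.

Lemma geom_prod1r : right_id (basis_blade set0) geom_prod.
Proof.
move=> M; apply/ffunP=> U; rewrite geom_prodE (bigD1 U) //= big1 ?addr0.
  by rewrite ffunE symdiffv eqxx inversions0r expr0 mul1r mulr1.
move=> S nSU; rewrite ffunE; case: eqP => [e|]; last by rewrite !mulr0.
by case/eqP: nSU; rewrite -[U](symdiffK S) e symdiff0.
Qed.

Lemma geom_prodDl : left_distributive geom_prod +%R.
Proof.
move=> M N P; apply/ffunP=> U; rewrite [RHS]ffunE !geom_prodE -big_split /=.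
by apply: eq_bigr => S _; rewrite ffunE mulrDl mulrDr.
Qed.

Lemma geom_prodDr : right_distributive geom_prod +%R.
Proof.
move=> M N P; apply/ffunP=> U; rewrite [RHS]ffunE !geom_prodE -big_split /=.
by apply: eq_bigr => S _; rewrite ffunE !mulrDr.
Qed.

Lemma basis_blade_neq0 S : basis_blade S != 0.
Proof.
by apply/eqP => /ffunP/(_ S)/eqP; rewrite !ffunE eqxx oner_eq0.
Qed.

HB.instance Definition _ := GRing.Zmodule_isNzRing.Build (multivector R n)
  geom_prodA geom_prod1l geom_prod1r geom_prodDl geom_prodDr
  (basis_blade_neq0 set0).

Lemma geom_prodZl (a : R) M N : a *: (M * N) = a *: M * N.
Proof.
apply/ffunP=> U; rewrite ffunE [in LHS]geom_prodE [RHS]geom_prodE mulr_sumr.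
by apply: eq_bigr => S _; rewrite [in RHS]ffunE mulrCA !mulrA.
Qed.

Lemma geom_prodZr (a : R) M N : a *: (M * N) = M * (a *: N).
Proof.
apply/ffunP=> U; rewrite ffunE [in LHS]geom_prodE [RHS]geom_prodE mulr_sumr.
by apply: eq_bigr => S _; rewrite [in RHS]ffunE mulrCA (mulrCA a).
Qed.

HB.instance Definition _ := GRing.Lmodule_isLalgebra.Build R (multivector R n)
  geom_prodZl.
HB.instance Definition _ := GRing.Lalgebra_isAlgebra.Build R (multivector R n)
  geom_prodZr.

Definition mvnorm M : R := Num.sqrt (\sum_S M S ^+ 2).

(** Reversion acts on grade k as (-1)^(k(k-1)/2). *)
Definition reversion M : multivector R n :=
  [ffun S : {set 'I_n} => (-1) ^+ 'C(#|S|, 2) * M S].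

(** Coordinatewise sum of the exponential series; the powers are for the
    geometric product. *)
Definition mvexp M : multivector R n :=
  [ffun S : {set 'I_n} => limn (series (fun k => (k`!%:R^-1 *: M ^+ k) S))].

Definition vec (x : 'rV[R]_n) : multivector R n :=
  \sum_i x 0 i *: basis_blade [set i].

Definition dot (x y : 'rV[R]_n) : R := \sum_i x 0 i * y 0 i.

End Products.

Section Characterization.
Variables (R : realType) (n : nat).
Implicit Types (S T U : {set 'I_n}) (x y : 'rV[R]_n).

Lemma vecE x S : vec x S = \sum_i x 0 i * (S == [set i])%:R.
Proof. by rewrite /vec sum_ffunE; apply: eq_bigr => i _; rewrite !ffunE. Qed.

Lemma bilin_vec (c : {set 'I_n} -> {set 'I_n} -> R)
    (Q : {set 'I_n} -> {set 'I_n} -> bool) x y :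
  \sum_S \sum_(T | Q S T) c S T * (vec x S * vec y T)
  = \sum_i \sum_(j | Q [set i] [set j])
      c [set i] [set j] * (x 0 i * y 0 j).
Proof.
have vecF (z : 'rV[R]_n) (F : {set 'I_n} -> R) :
    \sum_S F S * vec z S = \sum_i F [set i] * z 0 i.
  under eq_bigr do rewrite vecE mulr_sumr.
  rewrite exchange_big; apply: eq_bigr => i _ /=.
  rewrite (bigD1 [set i]) //= eqxx mulr1 big1 ?addr0 // => S /negPf ->.
  by rewrite !mulr0.
transitivity (\sum_S
    (\sum_T (if Q S T then c S T else 0) * vec y T) * vec x S).
  apply: eq_bigr => S _; rewrite big_mkcond mulr_suml; apply: eq_bigr => T _.
  by case: ifP => _; rewrite ?mul0r // -mulrA (mulrC (vec x S)).
rewrite vecF; apply: eq_bigr => i _; rewrite vecF [RHS]big_mkcond mulr_suml.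
apply: eq_bigr => j _.
by case: ifP => _; rewrite ?mul0r // -mulrA (mulrC (x 0 i)).
Qed.

Lemma vec_mul x y : vec x * vec y = (dot x y)%:A + wedge (vec x) (vec y).
Proof.
apply/ffunP=> U; rewrite [LHS]ffunE [RHS]ffunE [X in X + _]ffunE.
rewrite [X in _ + X]ffunE !bilin_vec ffunE mulr_suml -big_split.
apply: eq_bigr => i _ /=; rewrite big_mkcond [in RHS]big_mkcond /=.
rewrite [in LHS](bigD1 i) //= [in RHS](bigD1 i) //= addrA; congr (_ + _).
  rewrite symdiffv inversions1 ltnn expr0 mul1r disjoints1 inE eqxx /= addr0.
  by rewrite eq_sym; case: eqP; rewrite ?mulr1 ?mulr0.
apply: eq_bigr => j ji.
have dij : [disjoint [set i] & [set j]] by rewrite disjoints1 inE eq_sym.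
by rewrite dij (symdiff_disjoint dij).
Qed.

Lemma wedge_vecN x y : wedge (vec x) (vec y) = - wedge (vec y) (vec x).
Proof.
apply/ffunP=> U; rewrite [RHS]ffunE !ffunE !bilin_vec.
under eq_bigr do rewrite big_mkcond; rewrite exchange_big /= -sumrN.
apply: eq_bigr => j _; rewrite [in RHS]big_mkcond -sumrN.
apply: eq_bigr => i _ /=.
rewrite disjoint_sym setUC !inversions1 (mulrC (x 0 i)).
case: ifP => [/andP[dij _]|_]; last by rewrite oppr0.
rewrite -mulNr; congr (_ * _).
case: ltngtP dij => [_|_|/val_inj->]; rewrite ?expr0 ?expr1 ?opprK //.
by rewrite disjoints1 inE eqxx.
Qed.

Lemma wedge_basis S T :
  wedge (basis_blade R S) (basis_blade R T)
  = if [disjoint S & T] then (-1) ^+ inversions S T *: basis_blade R (S :|: T)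
    else 0.
Proof.
apply/ffunP=> U; rewrite ffunE (bigD1 S) //= [X in _ + X]big1 ?addr0; last first.
  move=> S' /negPf nS; rewrite big1 // => T' _.
  by rewrite !ffunE nS mul0r mulr0.
rewrite big_mkcond (bigD1 T) //= big1 ?addr0; last first.
  by move=> T' /negPf nT; rewrite !ffunE nT !mulr0 if_same.
case: disjoint; rewrite /= !ffunE // !eqxx !mulr1 eq_sym.
by case: eqP; rewrite ?mulr1 ?mulr0.
Qed.

End Characterization.

Section Blades.
Variables (R : realType) (n p : nat).
Implicit Types (v w e f : 'M[R]_(p, n)) (A B : multivector R n).

(** The blade v_1 /\ ... /\ v_p, where the v_i are the rows of v. *)
Definition outer_prod v : multivector R n :=
  \big[@wedge R n/1]_(i < p) vec (row i v).

Definition orthonormal_basis v e :=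
  (e == v)%MS /\ forall i j, dot (row i e) (row j e) = (i == j)%:R.

Record principal_bases v w (theta : 'I_p -> R) e f : Prop := PrincipalBases {
  principal_angle_range : forall i, 0 <= theta i <= pi / 2;
  principal_angle_mono : forall i j : 'I_p, (i <= j)%N -> theta i <= theta j;
  principal_basis_l : orthonormal_basis v e;
  principal_basis_r : orthonormal_basis w f;
  principal_dot : forall i j,
    dot (row i e) (row j f) = (i == j)%:R * cos (theta i) }.

(** Indices start at 0, so I_i = 0 for the first d = dim (V :&: W) indices is
    the condition i < d. *)
Definition principal_bivector v w e f (i : 'I_p) : multivector R n :=
  let b := wedge (vec (row i e)) (vec (row i f)) in
  if (i < \rank (v :&: w)%MS)%N then 0 else (mvnorm b)^-1 *: b.

Definition angle_bivector v w (theta : 'I_p -> R) e f : multivector R n :=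
  \sum_i theta i *: principal_bivector v w e f i.

(** The sign eps such that A = eps ||A|| e_1 ... e_p, when A is a nonzero blade
    whose space has e as an orthonormal basis. *)
Definition orientation A e : R :=
  if A == mvnorm A *: \prod_i vec (row i e) then 1 else -1.

Definition rel_orientation A B e f : R := orientation A e * orientation B f.

End Blades.

(** A and B are blades with [A] and [B] spanned by the rows of v and w. When
    these spaces coincide I_p = 0, so the correction by pi *: I_p vanishes and
    the oriented angle bivector is 0 whatever the relative orientation. *)
Definition oriented_angle_bivector (R : realType) (n p : nat)
    (A B : multivector R n) (v w : 'M[R]_(p.+1, n)) (theta : 'I_p.+1 -> R)
    (e f : 'M[R]_(p.+1, n)) : multivector R n :=
  if (A == 0) || (B == 0) then 0
  else if rel_orientation A B e f == 1 then angle_bivector v w theta e f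
  else angle_bivector v w theta e f - pi *: principal_bivector v w e f ord_max.

(* Main.v *)
Require Import Defs.
From mathcomp Require Import all_boot all_order all_algebra.
From mathcomp Require Import boolp reals topology normedtype sequences.
From mathcomp Require Import exp trigo ring lra.

(** In the Clifford algebra, A is a multiple of e_1 ... e_p and B a multiple of
    f_1 ... f_p, since wedging e_i with a product of distinct e_j gives either 0
    or the geometric product. The reversed product e_p ... e_1 f_1 ... f_p
    telescopes from the inside into the product of the e_i f_i, because e_i f_i
    commutes with e_j and f_j for j <> i. Each factor is
    cos theta_i + sin theta_i I_i = exp (theta_i I_i), where I_i^2 = -1 when
    theta_i <> 0, and the I_i commute. The exponential law for commuting
    multivectors then turns the product into the exponential of the angle
    bivector; a relative orientation -1 replaces theta_p by theta_p - pi. *)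

Set Implicit Arguments.
Unset Strict Implicit.
Unset Printing Implicit Defensive.

Import Order.TTheory GRing.Theory Num.Theory.
Import numFieldNormedType.Exports.

Local Open Scope classical_set_scope.
Local Open Scope ring_scope.

(** * The exponential law *)

(** Pairs with [i <= k] are reindexed by [(i, k - i)]: the Cauchy product regrouping for exponential
    sums. *)
Lemma sum_triangle (V : nmodType) (n : nat) (F : nat -> nat -> V) :
  \sum_(k < n) \sum_(i < k.+1) F i (k - i)%N
  = \sum_(i < n) \sum_(j < n | (i + j < n)%N) F i j.
Proof.
transitivity (\sum_(k < n) \sum_(i < n | (i <= k)%N) F i (k - i)%N).
  apply: eq_bigr => k _.
  by rewrite (big_ord_widen n (fun i => F i (k - i)%N) (ltn_ord k)).
rewrite (exchange_big_dep xpredT) //=; apply: eq_bigr => i _.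
rewrite -(big_geq_mkord _ _ xpredT (fun k => F i (k - i)%N)).
rewrite -{1}[i : nat]add0n big_addn.
under eq_bigr do rewrite addnK.
rewrite big_mkord (big_ord_widen n (F i) (leq_subr i n)).
by apply: eq_bigl => j; rewrite ltn_subRL.
Qed.

Section ExpSums.
Variables (K : numFieldType) (L : algType K).
Implicit Types x y : L.

Definition exp_sum n x := \sum_(k < n) k`!%:R^-1 *: x ^+ k.

(** By the binomial theorem the sum for [x + y] collects the terms of the expanded product with
    [i + j < n], so only the opposite corner of the square remains. *)
Lemma exp_sumD n x y : GRing.comm x y ->
  exp_sum n x * exp_sum n y - exp_sum n (x + y)
  = \sum_(i < n) \sum_(j < n | (n <= i + j)%N)
      (i`!%:R^-1 *: x ^+ i) * (j`!%:R^-1 *: y ^+ j).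
Proof.
move=> cxy; pose F i j := (i`!%:R^-1 *: x ^+ i) * (j`!%:R^-1 *: y ^+ j).
have -> : exp_sum n (x + y) = \sum_(k < n) \sum_(i < k.+1) F i (k - i)%N.
  apply: eq_bigr => k _; rewrite addrC exprDn_comm; last exact/commr_sym.
  rewrite scaler_sumr; apply: eq_bigr => i _.
  have ik : (i <= k)%N by rewrite -ltnS.
  rewrite /F -scalerAl -scalerAr [RHS](@scalerA K L).
  rewrite -(@scaler_nat K L 'C(k, i)) [LHS](@scalerA K L).
  rewrite (commrX _ (commr_sym (commrX _ (commr_sym cxy)))).
  congr (_ *: _).
  rewrite -(bin_fact ik) !natrM.
  have fN m : (m`!%:R : K) != 0 by rewrite pnatr_eq0 -lt0n fact_gt0.
  have bN : ('C(k, i)%:R : K) != 0 by rewrite pnatr_eq0 -lt0n bin_gt0.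
  by rewrite !invfM mulrC mulVKf.
rewrite sum_triangle [X in X - _]big_distrlr /= -sumrB; apply: eq_bigr => i _.
rewrite (bigID (fun j : 'I_n => (i + j < n)%N)) /= addrC addrK.
by apply: eq_bigl => j; rewrite -leqNgt.
Qed.

End ExpSums.

Section Exponential.
Variables (R : realType) (n : nat).
Implicit Types (M N : multivector R n) (S T U : {set 'I_n}).

(** The l1 norm of the coordinates serves because it is submultiplicative for the geometric product;
    [mvnorm] is not, as 1 + g_1 shows. *)
Definition mvnorm1 M : R := \sum_S `|M S|.

Lemma mvnorm1_ge0 M : 0 <= mvnorm1 M.
Proof. exact: sumr_ge0. Qed.

Lemma coef_le_mvnorm1 M S : `|M S| <= mvnorm1 M.
Proof. by rewrite /mvnorm1 (bigD1 S) //= lerDl sumr_ge0. Qed.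

Lemma mvnorm11 : mvnorm1 1 = 1.
Proof.
rewrite /mvnorm1 (bigD1 set0) //= ffunE eqxx normr1 big1 ?addr0 // => S S0.
by rewrite ffunE (negPf S0) normr0.
Qed.

Lemma mvnorm1Z a M : mvnorm1 (a *: M) = `|a| * mvnorm1 M.
Proof.
by rewrite /mvnorm1 mulr_sumr; apply: eq_bigr => S _; rewrite ffunE normrM.
Qed.

Lemma mvnorm1_sum I (r : seq I) (P : pred I) (F : I -> multivector R n) :
  mvnorm1 (\sum_(i <- r | P i) F i) <= \sum_(i <- r | P i) mvnorm1 (F i).
Proof.
rewrite /mvnorm1 exchange_big /=; apply: ler_sum => S _.
by rewrite sum_ffunE ler_norm_sum.
Qed.

(** Once the signs are dropped by the triangle inequality, the double sum factors, since [symdiff S]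
    is a bijection for each [S]. *)
Lemma mvnorm1M M N : mvnorm1 (M * N) <= mvnorm1 M * mvnorm1 N.
Proof.
apply: (@le_trans _ _ (\sum_U \sum_S `|M S| * `|N (symdiff S U)|)).
  apply: ler_sum => U _; rewrite geom_prodE (le_trans (ler_norm_sum _ _ _)) //.
  by apply: ler_sum => S _; rewrite !normrM normrX normrN normr1 expr1n mul1r.
rewrite exchange_big /mvnorm1 mulr_suml; apply: ler_sum => S _ /=.
by rewrite -mulr_sumr [in leRHS](reindex_inj (inv_inj (symdiffK S))).
Qed.

Lemma mvnorm1X M k : mvnorm1 (M ^+ k) <= mvnorm1 M ^+ k.
Proof.
elim: k => [|k IHk]; first by rewrite !expr0 mvnorm11.
by rewrite !exprS (le_trans (mvnorm1M _ _)) // ler_wpM2l ?mvnorm1_ge0.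
Qed.

Lemma exp_term_le M k :
  mvnorm1 (k`!%:R^-1 *: M ^+ k) <= k`!%:R^-1 * mvnorm1 M ^+ k.
Proof.
by rewrite mvnorm1Z ger0_norm ?invr_ge0 ?ler0n // ler_wpM2l ?mvnorm1X ?invr_ge0.
Qed.

Lemma exp_sumE M S m :
  exp_sum m M S = series (fun k => (k`!%:R^-1 *: M ^+ k) S) m.
Proof. by rewrite /series /= big_mkord sum_ffunE. Qed.

(** Each coordinate series is dominated by the real exponential series of [mvnorm1 M]. *)
Lemma exp_sum_cvg M S : exp_sum m M S @[m --> \oo] --> mvexp M S.
Proof.
under eq_fun do rewrite exp_sumE.
rewrite ffunE; apply: normed_cvg.
apply: series_le_cvg (is_cvg_series_exp_coeff (mvnorm1 M)) => k //=.
  by rewrite exp_coeff_ge0 ?mvnorm1_ge0.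
rewrite (le_trans (coef_le_mvnorm1 _ _)) // (le_trans (exp_term_le _ _)) //.
by rewrite mulrC.
Qed.

(** The reals are viewed as an algebra over themselves, so that [exp_sumD] also applies to norms. *)
Lemma exp_sumR (x : R) m : exp_sum m (x : R^o) = series (exp_coeff x) m.
Proof.
by rewrite /series /= big_mkord; apply: eq_bigr => k _; exact: mulrC.
Qed.

(* The defect of the partial sums is dominated by the same defect for the
   real numbers |M|_1 and |N|_1, which tends to 0 by expRD. *)
Lemma mvexpD M N : GRing.comm M N -> mvexp (M + N) = mvexp M * mvexp N.
Proof.
move=> cMN; apply/ffunP => U.
set a := mvnorm1 M; set b := mvnorm1 N.
pose D m := exp_sum m M * exp_sum m N - exp_sum m (M + N).
have prod_cvg : (exp_sum m M * exp_sum m N) U @[m --> \oo]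
    --> (mvexp M * mvexp N) U.
  under eq_fun do rewrite geom_prodE.
  rewrite geom_prodE.
  apply: cvg_big => [|S _]; first exact: add_continuous.
  apply: cvgM; first exact: cvg_cst.
  by apply: cvgM; apply: exp_sum_cvg.
have ab_cvg : series (exp_coeff a) m * series (exp_coeff b) m
    - series (exp_coeff (a + b)) m @[m --> \oo] --> (0 : R).
  rewrite -(subrr (expR (a + b))) {1}expRD.
  by apply: cvgB; [apply: cvgM|]; apply: is_cvg_series_exp_coeff.
have D_cvg : D m U @[m --> \oo] --> (0 : R).
  apply: norm_cvg0; apply: squeeze_cvgr ab_cvg; last exact: cvg_cst.
  apply: nearW => m; rewrite normr_ge0 /= (le_trans (coef_le_mvnorm1 _ _)) //.
  rewrite -!exp_sumR /D exp_sumD // exp_sumD; last exact: mulrC.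
  rewrite (le_trans (mvnorm1_sum _ _ _)) //; apply: ler_sum => i _.
  rewrite (le_trans (mvnorm1_sum _ _ _)) //; apply: ler_sum => j _.
  rewrite (le_trans (mvnorm1M _ _)) //.
  by apply: ler_pM; rewrite ?mvnorm1_ge0 ?exp_term_le.
have : exp_sum m (M + N) U @[m --> \oo] --> (mvexp M * mvexp N) U.
  rewrite -[X in _ --> X]subr0; under eq_fun => m.
    have -> : exp_sum m (M + N) U = (exp_sum m M * exp_sum m N) U - D m U.
      by rewrite !ffunE opprB addrCA subrr addr0.
    over.
  exact: cvgB.
exact: norm_cvg_unique (@exp_sum_cvg (M + N) U).
Qed.

Lemma mvexp0 : mvexp 0 = 1 :> multivector R n.
Proof.
apply/ffunP => S; apply: norm_cvg_unique (@exp_sum_cvg 0 S) _.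
have E m : exp_sum m.+1 (0 : multivector R n) = 1.
  rewrite /exp_sum big_ord_recl expr0 fact0 invr1 scale1r big1 ?addr0 // => i _.
  by rewrite expr0n scaler0.
(* The partial sum of index 0 is empty; the value is constantly 1 only from index 1 on. *)
by apply: cvg_near_cst; exists 1%N => // -[//|m] _; rewrite E.
Qed.

Lemma mvexp_sum I (r : seq I) (F : I -> multivector R n) :
  (forall i j, GRing.comm (F i) (F j)) ->
  mvexp (\sum_(i <- r) F i) = \prod_(i <- r) mvexp (F i).
Proof.
move=> cF; elim: r => [|i r IHr]; first by rewrite !big_nil mvexp0.
by rewrite !big_cons mvexpD ?IHr //; apply: commr_sum => j _; apply: cF.
Qed.

Lemma expr_sqrN1 (J : multivector R n) k : J ^+ 2 = -1 ->
  J ^+ k = (-1) ^+ k./2 *: J ^+ odd k.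
Proof.
move=> J2; rewrite -[in LHS](odd_double_half k) exprD -mul2n exprM J2.
rewrite -[-1 in X in X = _](scaleN1r (1 : multivector R n)).
by rewrite exprZn expr1n -scalerAr mulr1.
Qed.

(** Even powers of [J] are scalars and odd ones multiples of [J]; they sum to the cosine and sine
    series. *)
Lemma mvexpZ (J : multivector R n) (t : R) : J ^+ 2 = -1 ->
  mvexp (t *: J) = (cos t)%:A + sin t *: J.
Proof.
move=> J2; apply/ffunP => S; apply: norm_cvg_unique (@exp_sum_cvg _ S) _.
have -> : (fun m => exp_sum m (t *: J) S) =
    (fun m => series (cos_coeff t) m * (1 : multivector R n) S
              + series (sin_coeff t) m * J S).
  apply/funext => m; rewrite exp_sumE /series /= !mulr_suml -big_split /=.
  apply: eq_bigr => k _; rewrite exprZn expr_sqrN1 // 3!ffunE /=.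
  rewrite /cos_coeff /sin_coeff /= -exprnP.
  case: (boolP (odd k)) => ok.
    (* [sin_coeff] carries the exponent [k.-1./2], which agrees with [k./2] for odd [k]. *)
    have -> : k.-1./2 = k./2.
      by case: k ok => //= k /negPf ek; rewrite uphalf_half ek.
    by rewrite expr1 /= !mul0r add0r mul1r; ring.
  by rewrite expr0 /= !mul0r addr0 mul1r; ring.
have -> : ((cos t)%:A + sin t *: J) S
    = cos t * (1 : multivector R n) S + sin t * J S by rewrite !ffunE.
have cosl : series (cos_coeff t) @ \oo --> cos t.
  by rewrite cos.unlock; apply: is_cvg_series_cos_coeff.
have sinl : series (sin_coeff t) @ \oo --> sin t.
  by rewrite sin.unlock; apply: is_cvg_series_sin_coeff.
by apply: cvgD; apply: cvgM => //; apply: cvg_cst.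
Qed.

End Exponential.

(** * Reversion, grade involution and wedge products of vectors *)

Section Inversions.
Variable n : nat.
Implicit Types (S T : {set 'I_n}) (i : 'I_n).

(** Each pair [(i, j)] of [S] times [T] satisfies exactly one of [j < i], [i < j], [i = j]. *)
Lemma inversionsDC S T :
  (inversions S T + inversions T S + #|S :&: T| = #|S| * #|T|)%N.
Proof.
rewrite !inversionsE [X in (_ + X + _)%N]exchange_big /=.
have -> : #|S :&: T| = (\sum_i \sum_j ((i \in S) * (j \in T) * (i == j))%N)%N.
  rewrite -sum1_card big_mkcond; apply: eq_bigr => i _ /=.
  rewrite (bigD1 i) //= big1 => [|j /negPf ij]; last by rewrite eq_sym ij muln0.
  by rewrite eqxx addn0 muln1 inE; do 2!case: (_ \in _).
rewrite -!big_split /= -[#|S|]sum1_card -[#|T|]sum1_card big_distrl /=.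
rewrite [RHS]big_mkcond; apply: eq_bigr => i _ /=.
rewrite -!big_split /= mul1n [X in if _ then X else _]big_mkcond /=.
case: (i \in S); last first.
  by apply: big1 => j _; rewrite !mul0n addn0 muln0.
apply: eq_bigr => j _; rewrite -(inj_eq val_inj) /=.
by case: (j \in T); case: ltngtP.
Qed.

Lemma odd_inversionsC S T :
  odd (inversions S T)
  = odd (inversions T S) (+) odd (#|S| * #|T| + #|S :&: T|).
Proof. by rewrite -inversionsDC !oddD; do 3!case: (odd _). Qed.

Lemma inversionsv S : inversions S S = 'C(#|S|, 2).
Proof.
rewrite bin2 -subn1 mulnBr muln1 -inversionsDC setIid addnK addnn.
by rewrite doubleK.
Qed.

Lemma odd_card_symdiff S T : odd #|symdiff S T| = odd #|S| (+) odd #|T|.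
Proof.
rewrite cardsU (_ : _ :&: _ = set0) ?cards0 ?subn0; last first.
  by apply/setP => i; rewrite !inE; do 2!case: (i \in _).
rewrite -(cardsID T S) -(cardsID S T) setIC !oddD.
by do 3!case: (odd _).
Qed.

End Inversions.

Section Clifford.
Variables (R : realType) (n : nat).
Implicit Types (S T U : {set 'I_n}) (x y : 'rV[R]_n) (M N : multivector R n).

Lemma reversionE M S : reversion M S = (-1) ^+ inversions S S * M S.
Proof. by rewrite ffunE inversionsv. Qed.

(** Modulo 2, [inversions] is biadditive for [symdiff], so the reversion sign of g_S g_T splits into
    those of g_S and g_T and two cross terms, which exchange the sign of one product order for that
    of the other. *)
Lemma reversionM M N : reversion (M * N) = reversion N * reversion M.
Proof.
apply/ffunP => U; rewrite reversionE !geom_prodE mulr_sumr.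
rewrite (reindex_inj (inv_inj (symdiffK U))) /=; apply: eq_bigr => S _.
rewrite !reversionE [symdiff U S]symdiffC -[symdiff (symdiff S U) U]symdiffA.
rewrite symdiffv symdiff0; set T := symdiff S U.
have -> : U = symdiff S T by rewrite symdiffK.
rewrite (mulrC (M T)) [in RHS]mulrACA !mulrA -!exprD; do 2!congr (_ * _).
rewrite -[LHS]signr_odd -[RHS]signr_odd !oddD !odd_inversionsDl.
by rewrite !odd_inversionsDr; do 4!case: (odd _).
Qed.

Lemma reversionD M N : reversion (M + N) = reversion M + reversion N.
Proof. by apply/ffunP => S; rewrite !ffunE mulrDr. Qed.

Lemma reversionZ a M : reversion (a *: M) = a *: reversion M.
Proof. by apply/ffunP => S; rewrite !ffunE mulrCA. Qed.

Lemma reversion0 : reversion (0 : multivector R n) = 0.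
Proof. by apply/ffunP => S; rewrite !ffunE mulr0. Qed.

Lemma reversion1 : reversion (1 : multivector R n) = 1.
Proof.
apply/ffunP => S; rewrite !ffunE; case: eqP => [->|_]; last by rewrite mulr0.
by rewrite cards0 expr0 mulr1.
Qed.

Lemma reversion_vec x : reversion (vec x) = vec x.
Proof.
apply/ffunP => S; rewrite ffunE !vecE mulr_sumr; apply: eq_bigr => i _.
case: eqP => [->|_] /=; last by rewrite !mulr0. 
by rewrite cards1 expr0 mul1r.
Qed.

(** The reversion sign of g_S cancels the sign of g_S g_S, both being given by [inversions S S]. *)
Lemma sqr_mvnorm M : mvnorm M ^+ 2 = (reversion M * M) set0.
Proof.
rewrite /mvnorm sqr_sqrtr ?sumr_ge0 // => [|S _]; last exact: sqr_ge0.
rewrite geom_prodE; apply: eq_bigr => S _.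
by rewrite symdiff0 reversionE !mulrA -exprD addnn -muln2 exprM sqrr_sign mul1r.
Qed.

Lemma mvnorm_ge0 M : 0 <= mvnorm M.
Proof. exact: sqrtr_ge0. Qed.

Lemma mvnormZ a M : mvnorm (a *: M) = `|a| * mvnorm M.
Proof.
rewrite /mvnorm -sqrtr_sqr -sqrtrM ?sqr_ge0 // mulr_sumr; congr Num.sqrt.
by apply: eq_bigr => S _; rewrite ffunE exprMn.
Qed.

Lemma mvnorm0 : mvnorm (0 : multivector R n) = 0.
Proof. by rewrite /mvnorm big1 ?sqrtr0 // => S _; rewrite ffunE expr0n. Qed.

Lemma vec_mulDC x y : vec x * vec y + vec y * vec x = (dot x y *+ 2)%:A.
Proof.
rewrite !vec_mul [wedge (vec y) _]wedge_vecN addrACA subrr addr0 -scalerDl.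
rewrite mulr2n.
by congr ((_ + _) *: _); apply: eq_bigr => i _; rewrite mulrC.
Qed.

Lemma vec_mulN x y : dot x y = 0 -> vec x * vec y = - (vec y * vec x).
Proof.
by move=> xy0; apply/eqP; rewrite -addr_eq0 vec_mulDC xy0 mul0rn scale0r.
Qed.

Lemma vec_sqr x : vec x * vec x = (dot x x)%:A.
Proof.
apply: (scalerI (a := 2%:R)); rewrite ?pnatr_eq0 //.
by rewrite scaler_nat mulr2n vec_mulDC scalerA mulr_natl.
Qed.

(** The grade involution, the automorphism of the Clifford algebra that negates vectors. It lets
    wedging with a vector be written with geometric products. *)
Definition involution M : multivector R n :=
  [ffun S : {set 'I_n} => (-1) ^+ #|S| * M S].

Lemma involution1 : involution 1 = 1.
Proof.
apply/ffunP => S; rewrite !ffunE; case: eqP => [->|_]; last by rewrite mulr0.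
by rewrite cards0 mul1r.
Qed.

Lemma involutionD M N : involution (M + N) = involution M + involution N.
Proof. by apply/ffunP => S; rewrite !ffunE mulrDr. Qed.

Lemma involutionZ a M : involution (a *: M) = a *: involution M.
Proof. by apply/ffunP => S; rewrite !ffunE mulrCA. Qed.

Lemma involutionM M N : involution (M * N) = involution M * involution N.
Proof.
apply/ffunP => U; rewrite ffunE !geom_prodE mulr_sumr; apply: eq_bigr => S _.
rewrite !ffunE mulrCA; congr (_ * _).
rewrite [RHS]mulrACA -exprD; congr (_ * _).
rewrite -[LHS]signr_odd -[RHS]signr_odd oddD -odd_card_symdiff.
by rewrite symdiffK.
Qed.

Lemma vec_supp x S : #|S| != 1%N -> vec x S = 0.
Proof.
move=> S1; rewrite vecE big1 // => i _.
by case: (S =P [set i]) S1 => [->|_ _]; rewrite ?cards1 // mulr0.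
Qed.

Lemma involution_vec x : involution (vec x) = - vec x.
Proof.
apply/ffunP => S; rewrite ffunE [RHS]ffunE; have [->|S1] := eqVneq #|S| 1%N.
  by rewrite expr1 mulN1r.
by rewrite (vec_supp _ S1) mulr0 oppr0.
Qed.

(** For disjoint sets union and [symdiff] agree, which puts the wedge in the single-sum form of
    [geom_prodE] for termwise comparison. *)
Lemma wedgeE M N U :
  wedge M N U = \sum_(S : {set 'I_n}) if [disjoint S & symdiff S U]
    then (-1) ^+ inversions S (symdiff S U) * (M S * N (symdiff S U)) else 0.
Proof.
rewrite ffunE; apply: eq_bigr => S _.
rewrite (eq_bigl (fun T => (T == symdiff S U) && [disjoint S & T])); last first.
  move=> T; rewrite andbC -eq_symdiff; apply: andb_id2r => dST.
  by rewrite symdiff_disjoint.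
by rewrite big_mkcondr big_pred1_eq.
Qed.

(* For [#|S| = 1], exchanging [g_S] and [g_T] costs the sign of
   [#|T| - #|S :&: T|]. *)
Lemma wedge_vecE x M :
  2%:R *: wedge (vec x) M = vec x * M + involution M * vec x.
Proof.
apply/ffunP => U; rewrite ffunE [RHS]ffunE wedgeE !geom_prodE.
rewrite [X in _ + X](reindex_inj (inv_inj (symdiffK U))) /=.
rewrite mulr_sumr -big_split /=; apply: eq_bigr => S _.
rewrite [symdiff U S]symdiffC -[symdiff (symdiff S U) U]symdiffA.
rewrite symdiffv symdiff0; set T := symdiff S U.
have [S1|S1] := eqVneq #|S| 1%N; last first.
  by rewrite (vec_supp _ S1) !(mul0r, mulr0) if_same mulr0 addr0.
rewrite ffunE -(signr_odd _ (inversions T S)) odd_inversionsC S1 muln1 setIC.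
rewrite signr_addb !signr_odd exprD.
(* If [S] and [T] are disjoint the two terms agree, whence the factor 2; otherwise they meet in one
   index and the terms cancel. *)
case: (boolP [disjoint S & T]) => dST.
  have -> : S :&: T = set0 by apply/eqP; rewrite setI_eq0.
  rewrite cards0 expr0 mulr1 -mulrA -(mulrA _ (M T)) signrMK.
  by rewrite (mulrC (M T)) mulr_natl mulr2n.
have -> : #|S :&: T| = 1%N.
  apply/eqP; rewrite eqn_leq -{1}S1 subset_leq_card ?subsetIl //=.
  by rewrite card_gt0 setI_eq0.
rewrite mulr0 expr1 mulrN1 mulrN mulNr -mulrA -(mulrA _ (M T)) signrMK.
by rewrite (mulrC (M T)) subrr.
Qed.

End Clifford.

(** * Blades on an orthonormal basis *)

Section Anticommuting.
Variables (A : pzRingType) (I : eqType) (E : I -> A).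
Hypothesis E_anticomm : forall i j, i != j -> E i * E j = - (E j * E i).

Lemma prod_anticomm i s : i \notin s ->
  (\prod_(j <- s) E j) * E i = (-1) ^+ size s * (E i * \prod_(j <- s) E j).
Proof.
elim: s => [|j s IHs]; first by rewrite !big_nil !mul1r mulr1.
rewrite inE negb_or => /andP[ij /IHs {}IHs].
rewrite !big_cons -mulrA IHs /= exprSr -!mulrA mulN1r.
rewrite [LHS]mulrA commr_sign -mulrA; congr (_ * _).
by rewrite !mulrA [in RHS]E_anticomm // mulNr opprK.
Qed.

(** By induction, the head of [s] is located in [t] and moved to the front past [t1], at the cost of
    the parity of [size t1]; uniqueness keeps it out of [t1], so no square is ever formed. *)
Lemma perm_prod_anticomm s t : uniq s -> perm_eq s t ->
  exists b : bool, \prod_(j <- s) E j = (-1) ^+ b * \prod_(j <- t) E j.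
Proof.
elim: s t => [|i s IHs] t /=.
  by rewrite perm_sym => _ /perm_nilP ->; exists false; rewrite mul1r.
move=> /andP[iNs us] pst.
have it : i \in t by rewrite -(perm_mem pst) mem_head.
case/path.splitPr: it pst => t1 t2.
rewrite perm_sym perm_catC /= perm_cons perm_catC perm_sym => pst.
have [b IH] := IHs _ us pst.
have iNt1 : i \notin t1.
  by apply: contra iNs => it1; rewrite (perm_mem pst) mem_cat it1.
exists (b (+) odd (size t1)).
rewrite big_cons IH [LHS]mulrA commr_sign -mulrA !big_cat big_cons /=.
rewrite signr_addb signr_odd -[RHS]mulrA; congr (_ * _).
rewrite (mulrA (\prod_(j <- t1) E j)) prod_anticomm //.
by rewrite -(mulrA _ _ (\prod_(j <- t2) E j)) signrMK mulrA.
Qed.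

End Anticommuting.

Section OrthonormalBlades.
Variables (R : realType) (n p : nat) (e : 'M[R]_(p, n)).
Hypothesis e_orth : forall i j, dot (row i e) (row j e) = (i == j)%:R.
Implicit Types (s : seq 'I_p) (M N : multivector R n).

Local Notation E i := (vec (row i e)).

Let E_anticomm i j : i != j -> E i * E j = - (E j * E i).
Proof. by move=> ij; rewrite vec_mulN // e_orth (negPf ij). Qed.

Let E_sqr i : E i * E i = 1.
Proof. by rewrite vec_sqr e_orth eqxx scale1r. Qed.

Lemma involution_prod s :
  involution (\prod_(i <- s) E i) = (-1) ^+ size s * \prod_(i <- s) E i.
Proof.
elim: s => [|i s IHs]; first by rewrite !big_nil involution1 mul1r.
rewrite !big_cons involutionM involution_vec IHs mulrA mulNr commr_sign exprS.
by rewrite mulN1r !mulNr mulrA.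
Qed.

(** In [wedge_vecE], moving [E i] across the product cancels the involution sign when [i] is new, so
    the two terms agree. When [i] occurs, it is sorted to the front and squared to 1, and the two
    terms are opposite. *)
Lemma wedge_vec_prod i s : uniq s ->
  wedge (E i) (\prod_(j <- s) E j)
  = if i \in s then 0 else \prod_(j <- i :: s) E j.
Proof.
move=> us; apply: (scalerI (a := 2%:R)); rewrite ?pnatr_eq0 // wedge_vecE.
case: ifP => [is_s|/negbT iNs]; last first.
  rewrite involution_prod -mulrA prod_anticomm // signrMK big_cons.
  by rewrite scaler_nat mulr2n.
have [b ->] := perm_prod_anticomm E_anticomm us (perm_to_rem is_s).
have iNr : i \notin rem i s by rewrite mem_rem_uniqF.
rewrite big_cons scaler0 mulrA commr_sign involutionM.
have -> : involution ((-1) ^+ b) = (-1) ^+ b :> multivector R n.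
  case: b; rewrite ?expr1 ?expr0 ?involution1 //.
  by rewrite -scaleN1r involutionZ involution1.
rewrite -!mulrA -mulrDr mulrA E_sqr mul1r involutionM involution_vec.
rewrite involution_prod -!mulrA mulNr prod_anticomm // signrMK mulrA E_sqr.
by rewrite mul1r subrr mulr0.
Qed.

(** Weighted words need not be sorted or distinct from one another: sums become concatenation, and
    wedging prepends a letter. *)
Definition grade_span k M := exists r : seq (R * seq 'I_p),
  all (fun x => uniq x.2 && (size x.2 == k)) r /\
  M = \sum_(x <- r) x.1 *: \prod_(j <- x.2) E j.

Lemma grade_span0 k : grade_span k 0.
Proof. by exists [::]; split; rewrite // big_nil. Qed.

Lemma grade_spanD k M N :
  grade_span k M -> grade_span k N -> grade_span k (M + N).
Proof.
move=> [r [ar ->]] [s [as_ ->]]; exists (r ++ s); split.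
  by rewrite all_cat ar.
by rewrite big_cat.
Qed.

Lemma grade_spanZ k a M : grade_span k M -> grade_span k (a *: M).
Proof.
move=> [r [ar ->]]; exists [seq (a * x.1, x.2) | x <- r]; split.
  by rewrite all_map.
by rewrite big_map scaler_sumr; apply: eq_bigr => x _; rewrite scalerA.
Qed.

Lemma grade_span_sum I (r : seq I) (P : pred I) (F : I -> multivector R n) k :
  (forall i, P i -> grade_span k (F i)) ->
  grade_span k (\sum_(i <- r | P i) F i).
Proof.
move=> gF; apply: big_ind => // [|M N]; first exact: grade_span0.
exact: grade_spanD.
Qed.

Lemma vec_mulmx (a : 'rV[R]_p) : vec (a *m e) = \sum_i a 0 i *: E i.
Proof.
apply/ffunP => S; rewrite vecE [RHS]sum_ffunE.
under [RHS]eq_bigr do rewrite ffunE vecE mulr_sumr.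
rewrite exchange_big /=; apply: eq_bigr => j _.
rewrite mxE mulr_suml; by apply: eq_bigr => i _; rewrite mxE mulrA.
Qed.

(** Linearity is read off the right-hand side of [wedge_vecE], where only the bilinear geometric
    product occurs. *)
Lemma wedge_vec_suml I (r : seq I) (c : I -> R) (x : I -> 'rV[R]_n) y M :
  vec y = \sum_(i <- r) c i *: vec (x i) ->
  wedge (vec y) M = \sum_(i <- r) c i *: wedge (vec (x i)) M.
Proof.
move=> yE; apply: (scalerI (a := 2%:R)); rewrite ?pnatr_eq0 // wedge_vecE yE.
rewrite mulr_suml mulr_sumr -big_split scaler_sumr; apply: eq_bigr => i _ /=.
by rewrite scalerA mulrC -scalerA wedge_vecE scalerDr scalerAl scalerAr.
Qed.

Lemma wedge_vec_sumr I (r : seq I) (c : I -> R) (N : I -> multivector R n) y :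
  wedge (vec y) (\sum_(i <- r) c i *: N i)
  = \sum_(i <- r) c i *: wedge (vec y) (N i).
Proof.
apply: (scalerI (a := 2%:R)); rewrite ?pnatr_eq0 // wedge_vecE scaler_sumr.
under [RHS]eq_bigr do rewrite scalerA mulrC -scalerA wedge_vecE.
elim: r => [|i r IHr].
  rewrite !big_nil mulr0 add0r (_ : involution 0 = 0) ?mul0r //.
  by apply/ffunP => S; rewrite !ffunE mulr0.
rewrite !big_cons -IHr mulrDr involutionD involutionZ mulrDl addrACA.
by rewrite -scalerAl -scalerAr -scalerDr.
Qed.

Lemma grade_span_wedge k (a : 'rV[R]_p) M :
  grade_span k M -> grade_span k.+1 (wedge (vec (a *m e)) M).
Proof.
move=> [r [/allP ar ->]]; rewrite wedge_vec_sumr big_seq.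
apply: grade_span_sum => x xr; apply: grade_spanZ.
rewrite (wedge_vec_suml _ (vec_mulmx a)).
apply: grade_span_sum => i _; apply: grade_spanZ.
have /andP[ux /eqP sx] := ar _ xr.
rewrite wedge_vec_prod //; case: ifPn => [_|iNx]; first exact: grade_span0.
exists [:: (1, i :: x.2)]; split; first by rewrite /= iNx ux sx eqxx.
by rewrite big_seq1 scale1r.
Qed.

(** Successive wedging stays in [grade_span]. A word of [p] distinct letters in ['I_p] is a
    permutation of all indices, hence gives the full product up to sign. *)
Lemma outer_prod_pseudoscalar (v : 'M[R]_(p, n)) : (v <= e)%MS ->
  exists c : R, outer_prod v = c *: \prod_i E i.
Proof.
move=> /submxP[D vDe].
have gs (r : seq 'I_p) :
    grade_span (size r) (\big[@wedge R n/1]_(i <- r) vec (row i v)).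
  elim: r => [|i r IHr]; rewrite ?big_nil ?big_cons /=.
    by exists [:: (1, [::])]; split; rewrite // big_seq1 big_nil scale1r.
  by rewrite [in X in vec X]vDe row_mul; apply: grade_span_wedge.
have [r [/allP ar]] := gs (index_enum 'I_p); rewrite -/(outer_prod v) => ->.
suff [c cE] : exists c : R * seq 'I_p -> R, forall x, x \in r ->
    x.1 *: \prod_(j <- x.2) E j = c x *: \prod_i E i.
  by exists (\sum_(x <- r) c x); rewrite scaler_suml; apply: eq_big_seq.
have sE x : x \in r -> exists b : bool,
    \prod_(j <- x.2) E j = (-1) ^+ b * \prod_i E i.
  move=> /ar/andP[ux /eqP sx]; apply: perm_prod_anticomm => //.
  apply: uniq_perm => //; first exact: index_enum_uniq.
  have [] := uniq_min_size ux _ (eq_leq (esym sx)) => // i _.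
  exact: mem_index_enum.
(* [sE] only asserts that a sign exists; a decidable comparison makes it a function of [x]. *)
exists (fun x => if \prod_(j <- x.2) E j == \prod_i E i then x.1 else - x.1).
move=> x /sE[] [] ->; last by rewrite mul1r eqxx.
rewrite expr1 mulN1r; case: eqP => [->//|_].
by rewrite scalerN scaleNr.
Qed.

End OrthonormalBlades.

(** * Principal angles *)

Section UnitVectors.
Variables (R : realType) (n : nat) (x y : 'rV[R]_n).
Hypotheses (x1 : dot x x = 1) (y1 : dot y y = 1).

Lemma wedge_unitE : wedge (vec x) (vec y) = vec x * vec y - (dot x y)%:A.
Proof. by rewrite vec_mul addrC addKr. Qed.

Lemma reversion_wedge_unit :
  reversion (wedge (vec x) (vec y)) = - wedge (vec x) (vec y).
Proof.
rewrite wedge_unitE reversionD reversionM !reversion_vec -scaleNr reversionZ.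
rewrite reversion1; apply/eqP; rewrite -addr_eq0 addrACA [_ + vec x * _]addrC.
by rewrite vec_mulDC -!scalerDl mulr2n addrACA subrr addr0 scale0r.
Qed.

(** With c the dot product, (y x - c)(x y - c) = 1 - c (x y + y x) + c^2 = 1 - c^2, because the unit
    vectors square to 1 and x y + y x = 2 c. *)
Lemma sqr_wedge_unit :
  wedge (vec x) (vec y) ^+ 2 = - (1 - dot x y ^+ 2)%:A.
Proof.
have -> : wedge (vec x) (vec y) ^+ 2
    = - (reversion (wedge (vec x) (vec y)) * wedge (vec x) (vec y)).
  by rewrite reversion_wedge_unit mulNr opprK.
congr (- _).
rewrite wedge_unitE reversionD reversionM !reversion_vec -scaleNr reversionZ.
rewrite reversion1 scaleNr mulrBl !mulrBr.
rewrite mulrA -(mulrA (vec y)) vec_sqr x1 scale1r mulr1 vec_sqr y1 scale1r.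
rewrite -!scalerAl -!scalerAr !mul1r !mulr1 scalerA -expr2.
rewrite opprB addrACA -opprD -scalerDr vec_mulDC scalerA.
have -> : dot y x = dot x y by apply: eq_bigr => i _; rewrite mulrC.
rewrite -[X in X + _ + _](scale1r 1) -scaleNr -!scalerDl.
by congr (_ *: _); ring.
Qed.

Lemma mvnorm_wedge_unit :
  mvnorm (wedge (vec x) (vec y)) ^+ 2 = 1 - dot x y ^+ 2.
Proof.
rewrite sqr_mvnorm reversion_wedge_unit mulNr -expr2 sqr_wedge_unit opprK.
by rewrite !ffunE eqxx mulr1.
Qed.

End UnitVectors.

Lemma dot_self_eq0 (R : realType) n (x : 'rV[R]_n) : dot x x = 0 -> x = 0.
Proof.
move=> x0; apply/rowP => i; rewrite mxE; apply/eqP.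
by rewrite -sqrf_eq0 expr2 (psumr_eq0P _ x0) // => j _; rewrite -expr2 sqr_ge0.
Qed.

(** The equality case of Cauchy-Schwarz: the squared length of [x - y] is 1 - 2 + 1. *)
Lemma unit_dot1 (R : realType) n (x y : 'rV[R]_n) :
  dot x x = 1 -> dot y y = 1 -> dot x y = 1 -> x = y.
Proof.
move=> x1 y1 xy1; apply/eqP; rewrite -subr_eq0; apply/eqP/dot_self_eq0.
have -> : dot (x - y) (x - y) = dot x x - dot x y *+ 2 + dot y y.
  rewrite /dot -sumrMnl -sumrB -big_split; apply: eq_bigr => i _ /=.
  by rewrite !mxE; ring.
by rewrite x1 y1 xy1; ring.
Qed.

Lemma dot_mulmx (R : realType) n p q (a : 'M[R]_(p, n)) (b : 'M[R]_(q, n)) i j :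
  (a *m b^T) i j = dot (row i a) (row j b).
Proof. by rewrite mxE; apply: eq_bigr => k _; rewrite !mxE. Qed.

Section CommScale.
Variables (R : comNzRingType) (A : algType R).

Lemma comm_scale (x y : A) a : GRing.comm x y -> GRing.comm x (a *: y).
Proof. by move=> cxy; rewrite /GRing.comm -scalerAr -scalerAl cxy. Qed.

End CommScale.

Section PrincipalBases.
Variables (R : realType) (n p : nat) (v w e f : 'M[R]_(p, n)).
Variable theta : 'I_p -> R.
Hypothesis pvw : principal_bases v w theta e f.

Local Notation E i := (vec (row i e)).
Local Notation F i := (vec (row i f)).

Let e_orth i j : dot (row i e) (row j e) = (i == j)%:R.
Proof. exact: (principal_basis_l pvw).2. Qed.

Let f_orth i j : dot (row i f) (row j f) = (i == j)%:R.
Proof. exact: (principal_basis_r pvw).2. Qed.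

Let ef_orth i j : i != j -> dot (row i e) (row j f) = 0.
Proof. by move=> /negPf ij; rewrite (principal_dot pvw) ij mul0r. Qed.

Let e1 i : dot (row i e) (row i e) = 1.
Proof. by rewrite e_orth eqxx. Qed.

Let f1 i : dot (row i f) (row i f) = 1.
Proof. by rewrite f_orth eqxx. Qed.

Let ef_cos i : dot (row i e) (row i f) = cos (theta i).
Proof. by rewrite (principal_dot pvw) eqxx mul1r. Qed.

(** [E j] is orthogonal to both factors, so it anticommutes with each and the two signs cancel. *)
Let comm_EF_E i j : i != j -> GRing.comm (E i * F i) (E j).
Proof.
move=> ij; rewrite /GRing.comm -mulrA -[F i * _]opprK.
rewrite -(vec_mulN (ef_orth (_ : j != i))) 1?eq_sym // mulrN !mulrA.
by rewrite (@vec_mulN _ _ (row i e)) ?mulNr ?opprK // e_orth (negPf ij).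
Qed.

Let comm_EF_F i j : i != j -> GRing.comm (E i * F i) (F j).
Proof.
move=> ij; rewrite /GRing.comm -mulrA (@vec_mulN _ _ (row i f)); last first.
  by rewrite f_orth (negPf ij).
by rewrite mulrN !mulrA (@vec_mulN _ _ (row i e)) ?ef_orth // mulNr opprK.
Qed.

Lemma comm_principal_prod i j : GRing.comm (E i * F i) (E j * F j).
Proof.
have [->//|ij] := eqVneq i j.
by apply: commrM; [apply: comm_EF_E|apply: comm_EF_F].
Qed.

Lemma reversion_prod_mul (r : seq 'I_p) : uniq r ->
  reversion (\prod_(i <- r) E i) * \prod_(i <- r) F i
  = \prod_(i <- r) (E i * F i).
Proof.
elim: r => [|i r IHr] /=; first by rewrite !big_nil reversion1 mulr1.
move=> /andP[iNr /IHr {}IHr].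
rewrite !big_cons reversionM reversion_vec -mulrA (mulrA (vec _)).
(* The inner pair slides out past the remaining [F j], leaving the product for [r] to the induction
   hypothesis. *)
have -> : E i * F i * \prod_(j <- r) F j = \prod_(j <- r) F j * (E i * F i).
  rewrite big_seq; apply: commr_prod => j jr.
  by apply: comm_EF_F; apply: contraNneq iNr => ->.
rewrite mulrA IHr; apply/commr_sym/commr_prod => j _.
exact: comm_principal_prod.
Qed.

(** Translates the rank test of [principal_bivector] into a test on the angle. If [theta i = 0],
    monotonicity gives [e_j = f_j] for all [j <= i], so the intersection has rank above [i]. If not,
    it lies in the span of the first [i] vectors of [e]. *)
Lemma principal_angle_eq0 i : (theta i == 0) = (i < \rank (v :&: w)%MS)%N.
Proof.
have [/eqmxP ev _] := principal_basis_l pvw.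
have [/eqmxP fw _] := principal_basis_r pvw.
rewrite -(cap_eqmx ev fw).
have eeT : e *m e^T = 1%:M.
  by apply/matrixP => j k; rewrite dot_mulmx e_orth mxE.
have ffT : f *m f^T = 1%:M.
  by apply/matrixP => j k; rewrite dot_mulmx f_orth mxE.
have cos_inj0 j : cos (theta j) = 1 -> theta j = 0.
  move=> cj; apply: cos_inj; rewrite ?cos0 // in_itv /= ?lexx ?pi_ge0 //.
  have /andP[-> /le_trans] /= := principal_angle_range pvw j.
  by apply; have := pi_gt0 R; lra.
(* The first [k] rows of [e], used to bound the rank of the intersection from both sides. *)
pose g k (lt_k : (k <= p)%N) := rowsub (widen_ord lt_k) e.
have rank_g k lt_k : \rank (@g k lt_k) = k.
  apply/eqP/row_freeP; exists (g k lt_k)^T; apply/matrixP => a b.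
  rewrite dot_mulmx !row_rowsub e_orth mxE.
  by rewrite -(inj_eq val_inj).
apply/eqP/idP => [ti0|i_lt].
  rewrite -(rank_g i.+1 (ltn_ord i)) mxrankS // sub_capmx; apply/andP; split.
    by apply/row_subP => k; rewrite row_rowsub row_sub.
  apply/row_subP => k; rewrite row_rowsub.
  set j := widen_ord _ _; suff -> : row j e = row j f by rewrite row_sub.
  apply: unit_dot1 => //; rewrite ef_cos.
  suff -> : theta j = 0 by rewrite cos0.
  apply/eqP; rewrite eq_le (andP (principal_angle_range pvw j)).1 andbT -ti0.
  by apply: (principal_angle_mono pvw); exact: (ltn_ord k).
apply: contraTeq i_lt => ti0; rewrite -leqNgt -(rank_g i (ltnW (ltn_ord i))).
apply: mxrankS; apply/row_subP => k; set x := row k _.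
have : (x <= e :&: f)%MS by rewrite row_sub.
rewrite sub_capmx => /andP[/submxP[a xa] /submxP[b xb]].
have fe_cos j l : dot (row j f) (row l e) = (j == l)%:R * cos (theta l).
  by rewrite eq_sym -(principal_dot pvw); apply: eq_bigr => m _; rewrite mulrC.
(* A common vector has coordinates [a] on [e] and [b] on [f]; dotting with either basis yields one
   from the other through the cosines. *)
have ab j : a 0 j = b 0 j * cos (theta j).
  rewrite -[a]mulmx1 -eeT mulmxA -xa xb -mulmxA mxE (bigD1 j) //= dot_mulmx.
  rewrite fe_cos eqxx mul1r big1 ?addr0 // => l /negPf lj.
  by rewrite dot_mulmx fe_cos lj mul0r mulr0.
have ba j : b 0 j = a 0 j * cos (theta j).
  rewrite -[b]mulmx1 -ffT mulmxA -xb xa -mulmxA mxE (bigD1 j) //= dot_mulmx.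
  rewrite ef_cos big1 ?addr0 // => l lj.
  by rewrite dot_mulmx ef_orth ?mulr0.
rewrite xa mulmx_sum_row; apply: summx_sub => j _.
have [ji|ij] := ltnP j i.
  apply: scalemx_sub.
  have -> : row j e = row (Ordinal ji) (g i (ltnW (ltn_ord i))).
    by rewrite row_rowsub; congr row; apply: val_inj.
  exact: row_sub.
suff -> : a 0 j = 0 by rewrite scale0r sub0mx.
have cN1 : cos (theta j) != 1.
  apply: contra_neq ti0 => /cos_inj0 tj0; apply/eqP.
  rewrite eq_le (andP (principal_angle_range pvw i)).1 andbT -tj0.
  exact: (principal_angle_mono pvw).
have c_ge0 : 0 <= cos (theta j).
  apply: cos_ge0_pihalf; have := principal_angle_range pvw j.
  by have := pi_gt0 R; lra.
(* Combining [ab] and [ba] gives a = a c^2 with 0 <= c and c different from 1, which forces a =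
   0. *)
have /eqP : a 0 j * (1 - cos (theta j)) * (1 + cos (theta j)) = 0.
  apply/eqP; rewrite -mulrA -subr_sqr expr1n mulrBr mulr1 subr_eq0.
  by rewrite expr2 mulrA -ba -ab.
rewrite !mulf_eq0 subr_eq0 [1 == _]eq_sym (negPf cN1) orbF => /orP[/eqP//|].
by move: c_ge0; lra.
Qed.

Lemma mvnorm_principal_wedge i : mvnorm (wedge (E i) (F i)) = sin (theta i).
Proof.
apply/eqP; rewrite -(@eqrXn2 _ 2%N) ?mvnorm_ge0 //; last first.
  apply: sin_ge0_pi; have := principal_angle_range pvw i.
  by have := pi_gt0 R; lra.
by rewrite mvnorm_wedge_unit // ef_cos sin2cos2.
Qed.

Lemma sin_principal_angle_gt0 i : theta i != 0 -> 0 < sin (theta i).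
Proof.
move=> tiN0; apply: sin_gt0_pi; rewrite lt_def tiN0.
by have := principal_angle_range pvw i; have := pi_gt0 R; lra.
Qed.

Lemma principal_bivector0 i : theta i = 0 -> principal_bivector v w e f i = 0.
Proof. by move/eqP; rewrite principal_angle_eq0 /principal_bivector => ->. Qed.

Lemma principal_bivectorE i : theta i != 0 ->
  principal_bivector v w e f i = (sin (theta i))^-1 *: wedge (E i) (F i).
Proof.
rewrite principal_angle_eq0 /principal_bivector => /negPf ->.
by rewrite mvnorm_principal_wedge.
Qed.

(** The scalar part is the dot product, and the wedge has norm [sin (theta i)]. At angle 0 the two
    vectors coincide and the product is 1. *)
Lemma principal_prodE i : E i * F i
  = (cos (theta i))%:A + sin (theta i) *: principal_bivector v w e f i.
Proof.
have [ti0|tiN0] := eqVneq (theta i) 0.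
  rewrite (unit_dot1 (e1 i) (f1 i)) ?ef_cos ti0 ?cos0 //.
  by rewrite vec_sqr f1 sin0 scale0r addr0.
rewrite principal_bivectorE // scalerA.
rewrite divff ?gt_eqF ?sin_principal_angle_gt0 //.
by rewrite scale1r vec_mul ef_cos.
Qed.

Lemma sqr_principal_bivector i : theta i != 0 ->
  principal_bivector v w e f i ^+ 2 = -1.
Proof.
move=> tiN0; rewrite principal_bivectorE // exprZn sqr_wedge_unit // ef_cos.
rewrite -sin2cos2 scalerN scalerA -exprMn mulVf ?expr1n ?scale1r //.
by rewrite gt_eqF ?sin_principal_angle_gt0.
Qed.

(** Each bivector is 0 or a scalar multiple of [E k * F k] minus a scalar, so it commutes with
    whatever [E k * F k] commutes with; this is applied on each side in turn. *)
Lemma comm_principal_bivector i j :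
  GRing.comm (principal_bivector v w e f i) (principal_bivector v w e f j).
Proof.
suff cJ k (x : multivector R n) : GRing.comm x (E k * F k) ->
    GRing.comm x (principal_bivector v w e f k).
  by apply: (cJ); apply/commr_sym/cJ; apply: comm_principal_prod.
move=> cx; have [tk0|tkN0] := eqVneq (theta k) 0.
  by rewrite principal_bivector0 //; apply: commr0.
rewrite principal_bivectorE // wedge_unitE -scaleNr; apply: comm_scale.
by apply: commrD => //; apply: comm_scale; apply: commr1.
Qed.

(** Stated for arbitrary coefficients [t], to allow the last angle to be shifted by [pi]. Where
    [theta i = 0] the bivector vanishes and the factor is 1 whatever [t i] is. *)
Lemma mvexp_principal (t : 'I_p -> R) :
  mvexp (\sum_i t i *: principal_bivector v w e f i)
  = \prod_i if theta i == 0 then 1 else (cos (t i))%:A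
              + sin (t i) *: principal_bivector v w e f i.
Proof.
rewrite mvexp_sum => [|i j]; last first.
  by apply/comm_scale/commr_sym/comm_scale; apply: comm_principal_bivector.
apply: eq_bigr => i _; case: eqP => [ti0|/eqP tiN0].
  by rewrite principal_bivector0 // scaler0 mvexp0.
by rewrite mvexpZ ?sqr_principal_bivector.
Qed.

Lemma prod_principal_angles :
  \prod_i (E i * F i)
  = \prod_i if theta i == 0 then 1 else (cos (theta i))%:A
              + sin (theta i) *: principal_bivector v w e f i.
Proof.
apply: eq_bigr => i _; rewrite principal_prodE; case: eqP => // ->.
by rewrite cos0 sin0 scale0r addr0 scale1r.
Qed.

End PrincipalBases.

(** Both matrices have rank at most [p], so an intersection of rank [p] fills each row space. *)
Lemma eqmx_rank_capmx (F : fieldType) n p (v w : 'M[F]_(p, n)) :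
  (p <= \rank (v :&: w))%N -> (v == w)%MS.
Proof.
move=> p_le; apply/andP; split.
  have : (v <= v :&: w)%MS.
    rewrite -(mxrank_leqif_sup (capmxSl v w)) eqn_leq mxrankS ?capmxSl //.
    exact: leq_trans (rank_leq_row v) p_le.
  by rewrite sub_capmx => /andP[].
have : (w <= v :&: w)%MS.
  rewrite -(mxrank_leqif_sup (capmxSr v w)) eqn_leq mxrankS ?capmxSr //.
  exact: leq_trans (rank_leq_row w) p_le.
by rewrite sub_capmx => /andP[].
Qed.

(** * Orientation signs and the final computation *)

Section Orientation.
Variables (R : realType) (n p : nat) (v e : 'M[R]_(p, n)).
Hypothesis ve : orthonormal_basis v e.

Lemma mvnorm_prod_orthonormal : mvnorm (\prod_i vec (row i e)) = 1.
Proof.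
have rev_mul (r : seq 'I_p) :
    reversion (\prod_(i <- r) vec (row i e)) * \prod_(i <- r) vec (row i e) = 1.
  elim: r => [|i r IHr]; first by rewrite big_nil reversion1 mulr1.
  rewrite big_cons reversionM reversion_vec -mulrA (mulrA (vec _)) vec_sqr.
  by rewrite ve.2 eqxx scale1r mul1r.
apply/eqP; rewrite -(@eqrXn2 _ 2%N) ?mvnorm_ge0 // sqr_mvnorm rev_mul.
by rewrite ffunE eqxx expr1n.
Qed.

(** The blade is [c] times a product of norm 1, so its norm is the absolute value of [c]. The
    default -1 of [orientation] is correct because [c >= 0] would make its test succeed. *)
Lemma orientationP :
  outer_prod v = (orientation (outer_prod v) e * mvnorm (outer_prod v))
                 *: \prod_i vec (row i e).
Proof.
have /andP[_ v_le_e] := ve.1.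
have [c cE] := outer_prod_pseudoscalar ve.2 v_le_e.
rewrite /orientation; case: eqP => [{1}-> |]; first by rewrite mul1r.
rewrite cE mvnormZ mvnorm_prod_orthonormal mulr1 => cN.
rewrite ltr0_norm ?mulrN ?mulN1r ?opprK // ltNge.
by apply/negP => c_ge0; apply: cN; rewrite ger0_norm.
Qed.

End Orientation.

(** [hdegenerate] excludes opposite orientations of one space: there the left side is the negative
    scalar -||A|| ||B||, while the angle bivector is 0. *)
Theorem theorem4p1 (R : realType) (n p : nat)
    (v w : 'M[R]_(p.+1, n)) (A B : multivector R n)
    (theta : 'I_p.+1 -> R) (e f : 'M[R]_(p.+1, n))
    (hA : A = outer_prod v) (hB : B = outer_prod w)
    (hprincipal : A != 0 -> B != 0 -> principal_bases v w theta e f)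
    (hdegenerate : A != 0 -> B != 0 ->
       (v == w)%MS -> rel_orientation A B e f = 1) :
  reversion A * B
  = (mvnorm A * mvnorm B) *: mvexp (oriented_angle_bivector A B v w theta e f).
Proof.
rewrite /oriented_angle_bivector.
have [->|A0] := eqVneq A 0.
  by rewrite reversion0 mul0r mvnorm0 mul0r scale0r.
have [->|B0] := eqVneq B 0; first by rewrite mulr0 mvnorm0 mulr0 scale0r.
have pvw := hprincipal A0 B0; have {hdegenerate} hvw := hdegenerate A0 B0.
have AE := orientationP (principal_basis_l pvw); rewrite -hA in AE.
have BE := orientationP (principal_basis_r pvw); rewrite -hB in BE.
rewrite {1}AE {1}BE reversionZ -scalerAl -scalerAr scalerA mulrACA.
rewrite (reversion_prod_mul pvw) ?index_enum_uniq //.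
rewrite -/(rel_orientation A B e f).
rewrite mulrC -[LHS]scalerA; congr (_ *: _).
rewrite (prod_principal_angles pvw) /=.
case: eqP hvw => [-> _|oN1 hvw].
  by rewrite scale1r (mvexp_principal pvw).
have -> : rel_orientation A B e f = -1.
  move: oN1; rewrite /rel_orientation /orientation.
  by do 2![case: eqP => _]; rewrite ?mulr1 ?mul1r ?mulN1r ?opprK.
(* If the largest angle were 0, the intersection would have full rank and the spaces would coincide,
   against the relative orientation -1. *)
have tmax0 : theta ord_max != 0.
  rewrite (principal_angle_eq0 pvw) -leqNgt leqNgt; apply/negP => p_lt.
  by apply/oN1/hvw/eqmx_rank_capmx.
pose t i := if i == ord_max then theta i - pi else theta i.
have -> : angle_bivector v w theta e f
      - pi *: principal_bivector v w e f ord_max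
    = \sum_i t i *: principal_bivector v w e f i.
  rewrite /angle_bivector !big_ord_recr /= /t eqxx scalerBl addrA.
  congr (_ + _ - _); apply: eq_bigr => i _.
  by rewrite -(inj_eq val_inj) /= ltn_eqF.
rewrite (mvexp_principal pvw) !big_ord_recr /= (negPf tmax0) /t eqxx.
(* The sign -1 goes to the last factor, where shifting the angle by [pi] negates both cosine and
   sine; the other factors are unchanged. *)
rewrite scalerAr; congr (_ * _).
  by apply: eq_bigr => i _; rewrite -[_ == ord_max](inj_eq val_inj) /= ltn_eqF.
rewrite cosB sinB cospi sinpi !(mulrN1, mulr0) addr0 subr0.
by rewrite scalerDr scalerA !scaleN1r scaleNr mulN1r !scaleNr.
Qed.
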